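(* For every $\beta\in(2,3]$, $B_{\beta;02}$ is an invariant set of the local iterated function system $F_\beta$. Let $Q$ be the set of all $\beta\in(2,3]$ such that the $\beta$-expansion of $1$ is of the form $1=\frac{\epsilon_1}{\beta}+\cdots+\frac{\epsilon_k}{\beta^k}$ with $\epsilon_i\in\{0,2\}$. For every $\beta\in Q$, $B_{\beta;02}\neq C_{\beta;02}$ and $B_{\beta;02}\setminus C_{\beta;02}$ is a countable set of isolated points.
   Context: $\beta$-expansions: for real $\beta>1$ let $T_\beta:[0,1)\to[0,1)$, $T_\beta x=\beta x-\lfloor\beta x\rfloor$. For $x\in[0,1)$ put $a_k=\lfloor\beta\,T_\beta^{k-1}x\rfloor$, $k\ge1$; then $x=\sum_{k\ge1}a_k\beta^{-k}$, and $(a_1,a_2,\dots)$ is called the $\beta$-expansion of $x$. The $\beta$-expansion of $1$ is $1=\sum_{i\ge1}\epsilon_i\beta^{-i}$, where $\epsilon_1=\lfloor\beta\rfloor$ and $(\epsilon_2,\epsilon_3,\dots)$ is the $\beta$-expansion of $\beta-\lfloor\beta\rfloor$. A finite expression for the $\beta$-expansion of $1$ means that all later digits are $0$. $C_{\beta;02}$ is the closure in $\mathbb R$ of the set of all $x\in[0,1)$ whose $\beta$-expansion has all its digits in $\{0,2\}$. For $2<\beta\le3$, the local iterated function system $F_\beta$ consists of the maps $f_0:[0,1]\to[0,1]$, $f_0(x)=\frac{x}{\beta}$, and $f_2:[0,\beta-2]\to[0,1]$, $f_2(x)=\frac{x+2}{\beta}$. An invariant set of $F_\beta$ is a nonempty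 compact subset $A\subseteq[0,1]$ such that $A=f_0(A)\cup f_2(A\cap[0,\beta-2])$. The compact set $B_{\beta;02}\subseteq[0,1]$ is constructed by an interval removal process. Start with the single interval $[0,1]$. At step $n=1,2,3,\dots$, from each remaining closed interval $[u,v]$ (possibly degenerate) with $v-u>\frac1{\beta^n}$ remove the set $\left(u+\frac1{\beta^n},\,u+\frac2{\beta^n}\right)\cap[u,v]$, leaving one or two closed intervals; intervals with $v-u\le\frac1{\beta^n}$ are left unchanged at step $n$. (Step 1 removes $(\frac1\beta,\frac2\beta)$ from $[0,1]$.) $B_{\beta;02}$ is the set of points of $[0,1]$ that are never removed. *)

(* Defs.v *)
From HB Require Import structures.
From mathcomp Require Import all_boot all_order all_algebra.
From mathcomp Require Import all_classical all_reals all_analysis.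
Set Implicit Arguments.
Unset Strict Implicit.
Unset Printing Implicit Defensive.
Import Order.TTheory GRing.Theory Num.Theory.
Import numFieldNormedType.Exports.
Local Open Scope classical_set_scope.
Local Open Scope ring_scope.

Section BetaExpansions.
Context {R : realType}.
Implicit Types (beta x : R) (A : set R) (I : R * R).

Definition Tbeta beta x : R := beta * x - (Num.floor (beta * x))%:~R.

(* Digits are numbered from 1; index 0 is a junk value. *)
Definition beta_digit beta x (k : nat) : int :=
  Num.floor (beta * iter k.-1 (Tbeta beta) x).

(* Digits of the beta-expansion of 1, also numbered from 1. The first digit is
   floor beta, so at beta = 3 it is 3. *)
Definition beta_digit1 beta (i : nat) : int :=
  if (i <= 1)%N then Num.floor beta
  else beta_digit beta (beta - (Num.floor beta)%:~R) i.-1.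

Definition C02 beta : set R :=
  closure [set x : R | 0 <= x < 1 /\
    forall k : nat, (1 <= k)%N -> beta_digit beta x k = 0 \/ beta_digit beta x k = 2].

(* f0 is only meant to be applied on [0, 1], and f2 on [0, beta - 2]. *)
Definition f0 beta x : R := x / beta.
Definition f2 beta x : R := (x + 2) / beta.

Definition invariant_set beta A : Prop :=
  [/\ A !=set0, compact A, A `<=` `[0, 1]
    & A = f0 beta @` A `|` f2 beta @` (A `&` `[0, beta - 2])].

(* A pair I = (u, v) stands for the closed interval [u, v]. *)
Definition removed_part beta (n : nat) I : set R :=
  if beta ^- n < I.2 - I.1
  then `]I.1 + beta ^- n, I.1 + 2 * beta ^- n[ `&` `[I.1, I.2]
  else set0.

(* When v = u + 2 / beta^n, the right-hand piece is the degenerate interval {v}. *)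
Definition remaining_parts beta (n : nat) I : seq (R * R) :=
  if beta ^- n < I.2 - I.1 then
    if I.1 + 2 * beta ^- n <= I.2
    then [:: (I.1, I.1 + beta ^- n); (I.1 + 2 * beta ^- n, I.2)]
    else [:: (I.1, I.1 + beta ^- n)]
  else [:: I].

(* The intervals present after n steps; passing to n.+1 performs step n.+1. *)
Fixpoint remaining_intervals beta (n : nat) : seq (R * R) :=
  if n is m.+1
  then flatten (map (remaining_parts beta m.+1) (remaining_intervals beta m))
  else [:: (0, 1)].

Definition removed_at_step beta (n : nat) : set R :=
  \bigcup_(I in [set` remaining_intervals beta n.-1]) removed_part beta n I.

Definition B02 beta : set R :=
  `[0, 1] `\` \bigcup_(n in [set n : nat | (1 <= n)%N]) removed_at_step beta n.

Definition Q02 : set R := [set beta : R | 2 < beta <= 3 /\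
  exists k : nat, [/\ (1 <= k)%N,
    forall i : nat, (1 <= i <= k)%N ->
      beta_digit1 beta i = 0 \/ beta_digit1 beta i = 2
  & forall i : nat, (k < i)%N -> beta_digit1 beta i = 0]].

End BetaExpansions.

(* Main.v *)
Require Import Defs.
From HB Require Import structures.
From mathcomp Require Import all_boot all_order all_algebra.
From mathcomp Require Import all_classical all_reals all_analysis.
From mathcomp Require Import ring lra.
Import Order.TTheory GRing.Theory Num.Theory.
Import numFieldNormedType.Exports.
Local Open Scope classical_set_scope.
Local Open Scope ring_scope.

(** The removal process is governed by one expanding map S = [shift beta] of
    [0, 1]: multiplication by beta, followed by the subtraction of 2 when the
    product exceeds 1. If an interval [u, v] remains after n steps and x lies in
    it, then x = u + beta^-n S^n(x); hence step n+1 removes x exactly when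
    1 < beta S^n(x) < 2. So B02 is the set of the x in [0, 1] whose whole
    S-orbit avoids the gap (1/beta, 2/beta) ([B02P]). On B02 the two branches
    of S are inverse to f0 and f2, which gives the invariance
    ([B02_invariant]); compactness comes from writing B02 as the intersection
    over n of the finite unions of the remaining closed intervals.

    On [0, 1) and outside the gap, S and T_beta can only differ where beta y is
    1, which S sends to 1 and T_beta to 0. Therefore the points of [0, 1) with
    all digits in {0, 2} are the points of B02 whose S-orbit never hits 1
    ([digits02P]). Every point of B02 \ C02 has an S-orbit through 1, and there
    are countably many such points because S is at most two-to-one
    ([countable_hit1]).

    For beta in Q the expansion of 1 says that 1 is in B02 and that its S-orbit
    reaches 0 ([Q02_orbit1]). So if x in B02 has an orbit through 1, the orbit
    also passes through 0 later. Between two nearby points of B02 the iterates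
    of S are exact dilations ([B02_iter_expand]): a nearby y > x would be pushed
    above 1 when x reaches 1, and a nearby y < x below 0 when x reaches 0. Both
    are impossible in B02, so x is isolated ([B02_isolated_hit]). In particular
    1 is isolated in B02 without having its digits in {0, 2}, hence it is not
    in C02. *)

(** * The expanding map behind the removal process *)

Section IntervalRemoval.
Set Implicit Arguments.
Unset Strict Implicit.
Context {R : realType}.
Implicit Types (beta x y : R).

(** Unlike T_beta, this map sends y = 1 / beta to 1 and not to 0: the closed
    interval [0, 1 / beta] that survives a removal step is stretched onto the
    closed interval [0, 1]. *)
Definition shift beta y : R := if beta * y <= 1 then beta * y else beta * y - 2.

Definition in_gap beta y : bool := 1 < beta * y < 2.

Lemma shift_itv beta y : 2 < beta <= 3 ->
  0 <= y <= 1 -> ~~ in_gap beta y -> 0 <= shift beta y <= 1.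
Proof.
move=> hb /andP[y0 y1]; rewrite /in_gap /shift.
have [h _|h /= h2] := leP (beta * y) 1; first by apply/andP; split => //; nra.
by apply/andP; split; nra.
Qed.

Lemma exprVS_beta beta (n : nat) : 2 < beta <= 3 ->
  0 < beta ^- n.+1 /\ beta ^- n = beta * beta ^- n.+1.
Proof.
move=> hb; have b0 : 0 < beta by lra.
by rewrite invr_gt0 exprn_gt0// exprS invfM mulrA divff ?mul1r ?gt_eqF.
Qed.

(** After rescaling by beta^n, a remaining interval [u, v] becomes [0, s] with
    s <= 1, and one more step treats it as it would treat the first part of
    [0, 1]; the position of x in it, rescaled, is the n-th iterate. As
    this holds for every remaining interval that contains x, it takes the place
    of an argument that these intervals are pairwise disjoint. *)
Lemma remaining_intervals_shift beta (n : nat) (I : R * R) x : 2 < beta <= 3 ->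
  I \in remaining_intervals beta n -> I.1 <= x <= I.2 ->
  [/\ 0 <= I.1, I.2 <= 1, I.2 - I.1 <= beta ^- n,
      x = I.1 + beta ^- n * iter n (shift beta) x
    & forall m, (m < n)%N -> ~~ in_gap beta (iter m (shift beta) x)].
Proof.
move=> hb; elim: n I => [|n IHn] I /=.
  by rewrite inE => /eqP -> /= /andP[x0 x1]; split=> //; rewrite expr0; lra.
case/flattenP => s /mapP[J Jn ->] IJ xI.
have [q0 pq] := exprVS_beta n hb.
move: q0 pq IJ; rewrite /remaining_parts; set q := beta ^- n.+1 => q0 pq IJ.
have xJ : J.1 <= x <= J.2.
  move: IJ xI; case: ifP => [h|_]; last by rewrite inE => /eqP ->.
  by case: ifP => h2; rewrite !inE ?orbF; [case/orP|]; move/eqP=> -> /=; lra.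
have [J0 J1 Jlen xE gap] := IHn J Jn xJ.
set y := iter n (shift beta) x in xE *.
(* Only the piece of J that contains x matters: on it the rescaled position
   is multiplied by beta, and decreased by 2 on the right-hand piece. *)
suff [I0 I1 Ilen xE' gapn] : [/\ 0 <= I.1, I.2 <= 1, I.2 - I.1 <= q,
    x = I.1 + q * shift beta y & ~~ in_gap beta y].
  split=> // m; rewrite ltnS leq_eqVlt => /orP[/eqP ->//|]; exact: gap.
rewrite pq in xE.
have eqy : x - J.1 = q * (beta * y) by rewrite xE; ring.
move: IJ xI; rewrite /shift /in_gap; case: ifPn => [h|]; last first.
  rewrite -leNgt inE => h /eqP -> _.
  have y1 : beta * y <= 1 by nra.
  rewrite y1 [1 < _]ltNge y1 /=; split=> //; lra.
case: ifP => h2; rewrite !inE ?orbF; [case/orP|]; move/eqP=> -> /= xI.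
- have y1 : beta * y <= 1 by nra.
  by rewrite y1 [1 < _]ltNge y1 /=; split=> //; lra.
- have y2 : 2 <= beta * y by nra.
  have -> : (beta * y <= 1) = false by lra.
  rewrite [_ < 2]ltNge y2 andbF /=; split=> //; first by lra.
    rewrite pq in Jlen; nra.
  by rewrite mulrBr -eqy; lra.
- have y1 : beta * y <= 1 by nra.
  by rewrite y1 [1 < _]ltNge y1 /=; split=> //; lra.
Qed.

(** If beta times the rescaled position y exceeds 1, the interval is long enough
    to be cut at this step, since y is at most its rescaled length. *)
Lemma removed_part_gap beta (n : nat) (I : R * R) x : 2 < beta <= 3 ->
  I \in remaining_intervals beta n ->
  removed_part beta n.+1 I x <->
  I.1 <= x <= I.2 /\ in_gap beta (iter n (shift beta) x).
Proof.
move=> hb In; have [q0 pq] := exprVS_beta n hb.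
have key : I.1 <= x <= I.2 ->
    x - I.1 = beta ^- n.+1 * (beta * iter n (shift beta) x).
  move=> xI; have [_ _ _ xE _] := @remaining_intervals_shift _ _ _ _ hb In xI.
  by rewrite {1}xE pq; ring.
rewrite /removed_part /in_gap; split.
  case: ifP => // h [] /=; rewrite !in_itv /= => xg xI; split=> //.
  by have := key xI; nra.
move=> [xI /andP[y1 y2]]; have := key xI => {}key.
have -> : beta ^- n.+1 < I.2 - I.1 by nra.
by split=> /=; rewrite in_itv //=; apply/andP; split; nra.
Qed.

Lemma remaining_intervals_cover beta (n : nat) x : 2 < beta <= 3 ->
  0 <= x <= 1 ->
  (forall m, (m < n)%N -> ~~ in_gap beta (iter m (shift beta) x)) ->
  exists2 I, I \in remaining_intervals beta n & I.1 <= x <= I.2.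
Proof.
move=> hb x01; elim: n => [|n IHn] gap; first by exists (0, 1); rewrite ?inE.
have [I In xI] := IHn (fun m mn => gap m (ltnW mn)).
have ngap : ~ removed_part beta n.+1 I x.
  by move=> /(removed_part_gap _ hb In)[_]; apply/negP/gap.
have [q0 _] := exprVS_beta n hb.
suff [J JI xJ] : exists2 J, J \in remaining_parts beta n.+1 I & J.1 <= x <= J.2.
  exists J => //=; apply/flattenP.
  by exists (remaining_parts beta n.+1 I) => //; apply: map_f.
move: ngap; rewrite /removed_part /remaining_parts; case: ifP => h; last first.
  by exists I; rewrite ?inE.
move=> ng; have {}ng : x <= I.1 + beta ^- n.+1 \/ I.1 + 2 * beta ^- n.+1 <= x.
  have [|h1] := leP x (I.1 + beta ^- n.+1); first by left.
  have [|h2] := leP (I.1 + 2 * beta ^- n.+1) x; first by right.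
  by case: ng; split=> /=; rewrite in_itv /= ?h1 ?h2.
case: ng => [h1|h2].
  exists (I.1, I.1 + beta ^- n.+1) => /=; last lra.
  by case: ifP; rewrite inE eqxx.
exists (I.1 + 2 * beta ^- n.+1, I.2) => /=; last lra.
have -> : I.1 + 2 * beta ^- n.+1 <= I.2 by lra.
by rewrite !inE eqxx orbT.
Qed.

(** Points are removed by some interval at step n+1 exactly when the n-th iterate
    is in the gap, because a point that has survived so far is still covered. *)
Lemma B02P beta x : 2 < beta <= 3 ->
  B02 beta x <->
  0 <= x <= 1 /\ forall n, ~~ in_gap beta (iter n (shift beta) x).
Proof.
move=> hb; split=> [[]|[x01 gap]].
  rewrite /= in_itv /= => x01 nrem; split=> // n.
  elim/ltn_ind: n => n IHn; apply/negP => gapn.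
  have [I In xI] := remaining_intervals_cover hb x01 IHn.
  apply: nrem; exists n.+1 => //; exists I => //=.
  by apply/(removed_part_gap _ hb In).
split; first by rewrite /= in_itv.
move=> [[//|n] _ [I /= In]] /(removed_part_gap _ hb In)[_].
exact/negP/gap.
Qed.

Lemma B02_itv beta x : B02 beta x -> 0 <= x <= 1.
Proof. by case; rewrite /= in_itv. Qed.

(** * Topology and invariance of the surviving set *)

Lemma B02_cons beta x : 2 < beta <= 3 -> 0 <= x <= 1 ->
  B02 beta x <-> ~~ in_gap beta x /\ B02 beta (shift beta x).
Proof.
move=> hb x01; split.
  move=> /(B02P _ hb)[_ gap]; split; first exact: (gap 0%N).
  apply/(B02P _ hb); split; first exact: shift_itv (gap 0%N).
  by move=> n; rewrite -iterSr.
move=> [gap0 /(B02P _ hb)[_ gap]]; apply/(B02P _ hb); split=> // -[|n] //.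
by rewrite iterSr.
Qed.

Lemma B02_iter_shift beta (n : nat) x : 2 < beta <= 3 ->
  B02 beta x -> B02 beta (iter n (shift beta) x).
Proof.
move=> hb Bx; elim: n => //= n IHn.
by have /(B02_cons hb)[] := IHn; first exact: B02_itv IHn.
Qed.

(** A single removed part is only relatively open in its interval, so the
    complement description of B02 does not show that it is closed; the
    intersection of the unions of remaining intervals does. *)
Lemma B02_closed beta : 2 < beta <= 3 -> closed (B02 beta).
Proof.
move=> hb.
have -> : B02 beta =
    \bigcap_n \bigcup_(I in [set` remaining_intervals beta n]) `[I.1, I.2]%classic.
  apply/seteqP; split=> x.
    move=> /(B02P _ hb)[x01 gap] n _.
    have [I In xI] := remaining_intervals_cover hb x01 (fun m (_ : (m < n)%N) => gap m).
    by exists I => //=; rewrite in_itv.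
  move=> Ux; apply/(B02P _ hb); split.
    have [I /=] := Ux 0%N Logic.I.
    by rewrite inE => /eqP ->; rewrite in_itv.
  move=> n; have [I /= In] := Ux n.+1 Logic.I; rewrite in_itv /= => xI.
  have [_ _ _ _ gap] := @remaining_intervals_shift _ n.+1 _ _ hb In xI.
  exact: gap.
apply: closed_bigI => n _; apply: closed_bigcup; first exact: finite_seq.
by move=> I _; exact: itv_closed.
Qed.

(** The range of f0 is in [0, 1 / beta] and that of f2 is in [2 / beta, 1], the two
    sides of the gap, and [shift beta] undoes each of them. A point of B02
    beyond the gap has its shift in [0, beta - 2], which is the domain of f2. *)
Lemma B02_invariant beta : 2 < beta <= 3 -> invariant_set beta (B02 beta).
Proof.
move=> hb; have b0 : beta != 0 by apply/eqP; lra.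
have beta_f0 y : beta * f0 beta y = y by rewrite /f0 mulrC divfK.
have beta_f2 y : beta * f2 beta y = y + 2 by rewrite /f2 mulrC divfK.
split.
- exists 0; apply/(B02P _ hb); split; first lra.
  have iter0 n : iter n (shift beta) 0 = 0.
    by elim: n => //= n ->; rewrite /shift mulr0 ler01.
  by move=> n; rewrite iter0 /in_gap mulr0; lra.
- apply: (subclosed_compact (B02_closed hb) (@segment_compact R 0 1)).
  by move=> x /B02_itv; rewrite /= in_itv.
- by move=> x /B02_itv; rewrite /= in_itv.
apply/seteqP; split=> x.
  move=> Bx; have x01 := B02_itv Bx.
  have /(B02_cons hb x01)[] := Bx; rewrite /in_gap /shift.
  have [h _ Bs|h h2 Bs] := leP (beta * x) 1.
    by left; exists (beta * x) => //; rewrite /f0 mulrC mulKf.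
  right; exists (beta * x - 2); last by rewrite /f2 subrK mulrC mulKf.
  by split=> //=; have := B02_itv Bs; rewrite in_itv /=; nra.
case=> [[y By <-]|[y [By /=]]].
  have y01 := B02_itv By; have E := beta_f0 y.
  apply/(B02_cons hb); first by apply/andP; split; nra.
  rewrite /in_gap /shift E.
  have -> : y <= 1 by lra.
  by split=> //; lra.
rewrite in_itv /= => yb <-; have E := beta_f2 y.
apply/(B02_cons hb); first by apply/andP; split; nra.
rewrite /in_gap /shift E.
have -> : (y + 2 <= 1) = false by lra.
by rewrite addrK; split=> //; lra.
Qed.

(** * Isolation by expansion *)

(** Two points of B02 closer than 1 / beta lie on the same side of the gap, so
    the same affine branch of [shift beta] applies to both; the bound on the
    distance keeps this true for n steps. *)
Lemma B02_iter_expand beta (n : nat) x y : 2 < beta <= 3 ->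
  B02 beta x -> B02 beta y -> beta ^+ n * `|y - x| < 1 ->
  iter n (shift beta) y - iter n (shift beta) x = beta ^+ n * (y - x).
Proof.
move=> hb; elim: n x y => [|n IHn] x y Bx By; first by rewrite expr0 !mul1r.
have b0 : 0 < beta by lra.
have b1 : 1 <= beta by lra.
have bn1 : 1 <= beta ^+ n by exact: exprn_ege1.
rewrite exprSr -mulrA => lt1.
have bn_lt : beta * `|y - x| < 1.
  apply: le_lt_trans lt1; rewrite ler_peMl// mulr_ge0//; exact: ltW.
have /(B02_cons hb (B02_itv Bx))[gx Bsx] := Bx.
have /(B02_cons hb (B02_itv By))[gy Bsy] := By.
have E : shift beta y - shift beta x = beta * (y - x).
  move: bn_lt; rewrite -{1}(ger0_norm (ltW b0)) -normrM ltr_norml mulrBr.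
  move: gx gy; rewrite /in_gap /shift.
  by case: (leP (beta * y) 1); case: (leP (beta * x) 1) => /= ? ? ? ? /andP[? ?]; lra.
rewrite !iterSr IHn//; first by rewrite E mulrA.
by rewrite E normrM (ger0_norm (ltW b0)).
Qed.

(** The largest element 1 of [0, 1] in the orbit blocks neighbours on the right,
    and the smallest element 0 blocks neighbours on the left. *)
Lemma B02_isolated_hit beta (n m : nat) x : 2 < beta <= 3 -> B02 beta x ->
  iter n (shift beta) x = 1 -> iter (n + m) (shift beta) x = 0 ->
  exists2 V, nbhs x V & V `&` B02 beta = [set x].
Proof.
move=> hb Bx hit1 hit0; have b0 : 0 < beta by lra.
have b1 : 1 <= beta by lra.
have bN0 k : 0 < beta ^+ k by rewrite exprn_gt0.
exists (ball x (beta ^- (n + m))).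
  by apply: nbhsx_ballx; rewrite invr_gt0.
apply/seteqP; split=> [y [] | _ ->]; last first.
  by split=> //; apply: ballxx; rewrite invr_gt0.
rewrite -ball_normE /= distrC => near By.
have near_m : beta ^+ (n + m) * `|y - x| < 1 by rewrite mulrC -ltr_pdivlMr// div1r.
have near_n : beta ^+ n * `|y - x| < 1.
  apply: le_lt_trans near_m; apply: ler_wpM2r => //.
  by apply: ler_weXn2l; [exact: b1|exact: leq_addr].
have En := B02_iter_expand hb Bx By near_n.
have Em := B02_iter_expand hb Bx By near_m.
have le1 := B02_itv (B02_iter_shift n hb By).
have ge0 := B02_itv (B02_iter_shift (n + m) hb By).
have bn := bN0 n; have bm := bN0 (n + m)%N.
rewrite hit1 in En; rewrite hit0 in Em.
by apply/eqP; rewrite eq_le; apply/andP; split; nra.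
Qed.

(** * Points with digits 0 and 2 *)

(** The set whose closure is [C02]; it is named to compare it with [B02]. *)
Definition digits02 beta : set R := [set x : R | 0 <= x < 1 /\
  forall k : nat, (1 <= k)%N -> beta_digit beta x k = 0 \/ beta_digit beta x k = 2].

Lemma Tbeta_itv beta y : 0 <= Tbeta beta y < 1.
Proof.
have := floor_itv (beta * y); rewrite /Tbeta rmorphD /=; lra.
Qed.

Lemma shift_digit beta y : 2 < beta <= 3 -> 0 <= y < 1 ->
  Num.floor (beta * y) = 0 \/ Num.floor (beta * y) = 2 ->
  ~~ in_gap beta y /\ shift beta y = Tbeta beta y.
Proof.
move=> hb y01; rewrite /in_gap /shift /Tbeta => -[] fl.
all: have := floor_itv (beta * y); rewrite fl rmorphD /= => h.
  have -> : beta * y <= 1 by lra.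
  by split; lra.
have -> : (beta * y <= 1) = false by lra.
by split; lra.
Qed.

Lemma digit_shift beta y : 2 < beta <= 3 -> 0 <= y < 1 ->
  ~~ in_gap beta y -> shift beta y != 1 ->
  Num.floor (beta * y) = 0 \/ Num.floor (beta * y) = 2.
Proof.
move=> hb y01; rewrite /in_gap /shift.
have [h _ /eqP ne1|h gap _] := leP (beta * y) 1.
  left; apply: floor_def; rewrite rmorphD /=.
  by apply/andP; split; [nra|rewrite add0r lt_neqAle h andbT; exact/eqP].
right; apply: floor_def; rewrite rmorphD /=.
by apply/andP; split; nra.
Qed.

(** The map T_beta keeps [0, 1) invariant, so an orbit of [shift beta] that follows
    it never hits 1; conversely, as long as the orbit in B02 avoids 1 it stays
    in [0, 1) and beta times each iterate is in [0, 1) or [2, 3). At beta = 3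
    the digit 3 is excluded as well because the iterates are below 1. *)
Lemma digits02P beta x : 2 < beta <= 3 ->
  digits02 beta x <->
  B02 beta x /\ forall n, iter n (shift beta) x != 1.
Proof.
move=> hb; split=> [[x01 dig]|[Bx ne1]].
  have orb n : 0 <= iter n (Tbeta beta) x < 1.
    by case: n => [|n] //=; exact: Tbeta_itv.
  have step n := @shift_digit beta (iter n (Tbeta beta) x) hb (orb n) (dig n.+1 isT).
  have E n : iter n (shift beta) x = iter n (Tbeta beta) x.
    by elim: n => //= n ->; case: (step n).
  split; last by move=> n; rewrite E lt_eqF//; case/andP: (orb n).
  apply/(B02P _ hb); split; first lra.
  by move=> n; rewrite E; case: (step n).
have lt1 n : 0 <= iter n (shift beta) x < 1.
  have /andP[-> le1] := B02_itv (B02_iter_shift n hb Bx).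
  by rewrite lt_neqAle le1 ne1.
have /(B02P _ hb)[_ gap] := Bx.
have dig n := @digit_shift beta _ hb (lt1 n) (gap n) (ne1 n.+1).
have E n : iter n (Tbeta beta) x = iter n (shift beta) x.
  elim: n => //= n ->.
  by have [_ ->] := shift_digit hb (lt1 n) (dig n).
split; first exact: (lt1 0%N).
by case=> // k _; rewrite /beta_digit /= E.
Qed.

Lemma digits02_subset_B02 beta : 2 < beta <= 3 -> digits02 beta `<=` B02 beta.
Proof. by move=> hb x /(digits02P _ hb)[]. Qed.

(** A preimage of y under [shift beta] is f0 y or f2 y, so each level of preimages
    of 1 is countable. *)
Lemma countable_hit1 beta (n : nat) : 2 < beta <= 3 ->
  countable [set x | iter n (shift beta) x = 1].
Proof.
move=> hb; have b0 : beta != 0 by apply/eqP; lra.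
elim: n => [|n IHn]; first exact: countable1.
apply: (@sub_countable _ _ _ (\bigcup_(y in [set y | iter n (shift beta) y = 1])
    [set f0 beta y; f2 beta y])).
  apply: subset_card_le => x hx; have {}hx : iter n.+1 (shift beta) x = 1 by [].
  rewrite iterSr in hx.
  exists (shift beta x) => //; rewrite /shift /f0 /f2 /=.
  case: ifP => _; [left|right]; first by rewrite mulrC mulKf.
  by rewrite subrK mulrC mulKf.
apply: bigcup_countable => // y _; apply: finite_set_countable.
exact: finite_set2.
Qed.

(** With all digits 0 the iterates are beta^n x, which stay below 1. *)
Lemma digits_zero beta x : 2 < beta <= 3 -> 0 <= x < 1 ->
  (forall k : nat, (1 <= k)%N -> beta_digit beta x k = 0) -> x = 0.
Proof.
move=> hb x01 dig.
have E n : iter n (Tbeta beta) x = beta ^+ n * x.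
  elim: n => [|n IHn]; first by rewrite mul1r.
  have := dig n.+1 isT; rewrite /beta_digit /= /Tbeta => ->.
  by rewrite subr0 IHn exprS mulrA.
apply/eqP; apply: contraT => x0; have {}x0 : 0 < x by rewrite lt_neqAle eq_sym x0; lra.
have ix0 : 0 < x^-1 by rewrite invr_gt0.
have := archi_boundP (ltW ix0); set N := Num.bound _ => ltN.
(* beta > 2, so beta^N >= 2^N > N, where N exceeds 1 / x. *)
have leN : N%:R <= beta ^+ N.
  apply: (@le_trans _ _ (2 ^+ N)).
    by rewrite -natrX ler_nat ltnW// ltn_expl.
  by apply: lerXn2r; rewrite ?nnegrE; lra.
have lt1 : beta ^+ N * x < 1.
  rewrite -E; case: (N) => [|n] /=; first lra.
  by case/andP: (Tbeta_itv beta (iter n (Tbeta beta) x)).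
have : x^-1 * x < beta ^+ N * x by rewrite ltr_pM2r//; lra.
by rewrite mulVf ?gt_eqF//; lra.
Qed.

(** The digits of 1 are in {0, 2} at every rank, as the later ones vanish. Hence
    its first digit is 2, the remainder beta - 2 is a point with digits in
    {0, 2}, and its orbit reaches 0 when only zero digits are left. *)
Lemma Q02_orbit1 beta : Q02 beta ->
  B02 beta 1 /\ exists m, iter m (shift beta) 1 = 0.
Proof.
move=> [hb [k [k1 dig dig0]]].
have digit i : (1 <= i)%N -> beta_digit1 beta i = 0 \/ beta_digit1 beta i = 2.
  by move=> i1; have [ik|ik] := leqP i k; [apply: dig; rewrite i1|left; exact: dig0].
have fl2 : Num.floor beta = 2.
  have := digit 1%N isT; rewrite /beta_digit1 /= => -[] // fl0.
  by exfalso; have := floor_itv beta; rewrite fl0 rmorphD /=; lra.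
have b3 : beta < 3 by have := floor_itv beta; rewrite fl2 rmorphD /=; lra.
set z := beta - 2.
have zE : beta - (Num.floor beta)%:~R = z by rewrite fl2.
have z01 : 0 <= z < 1 by rewrite /z; lra.
have s1 : shift beta 1 = z.
  rewrite /shift mulr1.
  by have -> : (beta <= 1) = false by lra.
have zdig i : (1 <= i)%N -> beta_digit beta z i = beta_digit1 beta i.+1.
  by case: i => // i _; rewrite /beta_digit1 zE.
have zD : digits02 beta z.
  by split=> // i i1; rewrite zdig//; exact: digit.
have [Bz _] := (digits02P z hb).1 zD.
split.
  apply/(B02_cons hb); first lra.
  by rewrite s1 /in_gap mulr1; split=> //; lra.
have orb n : iter n (Tbeta beta) z = iter n (shift beta) z.
  elim: n => //= n <-.
  have y01 : 0 <= iter n (Tbeta beta) z < 1.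
    by case: (n) => [|j] //=; exact: Tbeta_itv.
  by have [_ ->] := shift_digit hb y01 (zD.2 n.+1 isT).
(* Digit i of z is digit i.+1 of 1, so z has only zero digits from rank k on and
   k.-1 iterations take it to 0; one more accounts for 1 itself. *)
exists k; case: k k1 {dig} dig0 => // j _ dig0.
rewrite iterSr s1 -orb; apply: (@digits_zero beta) => //.
  by case: (j) => [|i] //=; exact: Tbeta_itv.
case=> // i _; rewrite /beta_digit /= -iterD.
have := zdig (i + j).+1 isT; rewrite /beta_digit /= => ->.
by apply: dig0; rewrite !ltnS leq_addl.
Qed.

End IntervalRemoval.

Theorem theorem6 (R : realType) :
  (forall beta : R, 2 < beta <= 3 -> invariant_set beta (B02 beta)) /\
  (forall beta : R, Q02 beta ->
     [/\ B02 beta <> C02 beta,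
         countable (B02 beta `\` C02 beta)
       & B02 beta `\` C02 beta `<=` isolated (B02 beta)]).
Proof.
split=> [|beta Qb]; first exact: B02_invariant.
have [hb _] := Qb; have [B1 [m hit0]] := Q02_orbit1 Qb.
have hit x : B02 beta x -> ~ digits02 beta x ->
    exists n, iter n (shift beta) x = 1.
  move=> Bx nDx; apply: contrapT => nhit; apply/nDx/(digits02P _ hb).
  by split=> // n; apply/eqP => hn; apply: nhit; exists n.
have iso x : B02 beta x -> ~ digits02 beta x ->
    exists2 V, nbhs x V & V `&` B02 beta = [set x].
  move=> Bx nDx; have [n hn] := hit _ Bx nDx.
  by apply: (@B02_isolated_hit _ _ n m) => //; rewrite addnC iterD hn.
have nD x : ~ C02 beta x -> ~ digits02 beta x.
  by move=> nCx Dx; apply/nCx/subset_closure.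
split.
(* The neighbourhood that isolates 1 in B02 misses every point of digits02. *)
- have nD1 : ~ digits02 beta 1 by case; rewrite ltxx andbF.
  move=> BC; have : C02 beta 1 by rewrite -BC.
  have [V V1 VB] := iso 1 B1 nD1.
  move=> /(_ V V1)[y [Dy Vy]].
  have By := digits02_subset_B02 hb Dy.
  have : [set (1 : R)] y by rewrite -VB.
  by move=> /= y1; apply: nD1; rewrite -y1.
- apply: (@sub_countable _ _ _ (\bigcup_n [set x | iter n (shift beta) x = 1])).
    apply: subset_card_le => x [Bx /nD nDx].
    by have [n hn] := hit x Bx nDx; exists n.
  by apply: bigcup_countable => // n _; exact: countable_hit1.
- move=> x [Bx /nD nDx]; split; first exact: mem_set.
  exact: iso.
Qed.
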